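(* Let $a\in\,]0,1[$, $b=\sqrt{1-a^2}$, and let $n_1,n_2$ be positive integers with $n_1+n_2=n-1$. If the Clifford torus $\mathbb{T}^{n_1+n_2}(a,b)=\mathbb{S}^{n_1}(a)\times\mathbb{S}^{n_2}(b)\subset\mathbb{S}^n$ is not harmonic in $\mathbb{S}^n$, then it is biharmonic of index $\bigl(1-\frac{b^2}{a^2}\bigr)n_1+\bigl(1-\frac{a^2}{b^2}\bigr)n_2$ in $\mathbb{S}^n$.
   Context: $\mathbb{S}^n\subset\mathbb{R}^{n+1}$ is the unit sphere with its canonical metric. The generalized Clifford torus is $\mathbb{T}^{n_1+n_2}(a,b)=\{(x,y)\in\mathbb{R}^{n_1+1}\times\mathbb{R}^{n_2+1}: |x|=a,\ |y|=b\}\subset\mathbb{S}^n$, with the induced metric. For an $m$-dimensional submanifold $M\subset\mathbb{S}^n$ with inclusion $i$ and second fundamental form $B$, the mean curvature is $H=\frac1m\operatorname{tr}B$; $M$ is harmonic in $\mathbb{S}^n$ iff $H=0$. With $\Delta=-\operatorname{tr}\nabla^2$ the (nonnegative) rough Laplacian on sections of $i^*T\mathbb{S}^n$, $M$ is biharmonic of index $k\in\mathbb{R}$ in $\mathbb{S}^n$ if $(\Delta-m+k)H=0$. *)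

(* Defs.v *)
From mathcomp Require Import all_boot all_order all_algebra.
From mathcomp Require Import mathcomp_extra boolp classical_sets reals.
From mathcomp Require Import topology normedtype derive.

Set Implicit Arguments.
Unset Strict Implicit.
Unset Printing Implicit Defensive.

Import Order.TTheory GRing.Theory Num.Theory.
Import numFieldNormedType.Exports.

Local Open Scope classical_set_scope.
Local Open Scope ring_scope.

(* The norm that the library puts on row vectors is the sup norm: it is used
   only for topology and differentiation; lengths and angles come from [dot]. *)
Definition dot {R : realType} {N : nat} (u v : 'rV[R]_N) : R :=
  \sum_(i < N) u 0 i * v 0 i.

Definition enorm {R : realType} {N : nat} (u : 'rV[R]_N) : R :=
  Num.sqrt (dot u u).

(* The unit sphere of R^N, that is, S^n for N = n + 1. *)
Definition unit_sphere {R : realType} {N : nat} : set 'rV[R]_N :=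
  [set p | enorm p = 1].

(* R^(n1+1) x R^(n2+1) is identified with R^((n1+1)+(n2+1)), so the torus lies
   in S^n for n = n1 + n2 + 1. *)
Definition clifford_torus {R : realType} (n1 n2 : nat) (a b : R) :
    set 'rV[R]_(n1.+1 + n2.+1) :=
  [set z | enorm (lsubmx z) = a /\ enorm (rsubmx z) = b].
Arguments clifford_torus {R} n1 n2 a b _.

Fixpoint class_C {R : realType} {V W : normedModType R} (k : nat) (U : set V)
    (f : V -> W) : Prop :=
  match k with
  | 0%N => forall x, U x -> {for x, continuous f}
  | k'.+1 => (forall x, U x -> differentiable f x) /\
             (forall v, class_C k' U ('D_v f))
  end.

Definition smooth_on {R : realType} {V W : normedModType R} (U : set V)
    (f : V -> W) : Prop :=
  forall k, class_C k U f.

(* As phi is continuous on U, the last two conditions say that it is a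
   homeomorphism from U onto an open subset of M (for the subspace topology). *)
Record local_parametrization {R : realType} {m N : nat} (M : set 'rV[R]_N)
    (U : set 'rV[R]_m) (phi : 'rV[R]_m -> 'rV[R]_N) : Prop :=
  LocalParametrization {
    lp_open : open U;
    lp_smooth : smooth_on U phi;
    lp_immersion : forall u, U u -> injective ('d phi u);
    lp_injective : {in U &, injective phi};
    lp_open_map : forall O, open O -> O `<=` U ->
      exists2 O', open O' & phi @` O = M `&` O'
  }.

Definition submanifold_of_sphere {R : realType} {N : nat} (m : nat)
    (M : set 'rV[R]_N) : Prop :=
  M `<=` unit_sphere /\
  forall p, M p ->
    exists (U : set 'rV[R]_m) (phi : 'rV[R]_m -> 'rV[R]_N),
      local_parametrization M U phi /\ (phi @` U) p.

(* The geometry of a submanifold of the unit sphere, in the coordinates of a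
   local parametrization phi; a section of i^*TS^n is given in these
   coordinates by a map V : R^m -> R^N with V u orthogonal to phi u. *)
Section LocalGeometry.
Context {R : realType} {m N : nat}.
Implicit Types (phi V : 'rV[R]_m -> 'rV[R]_N) (u : 'rV[R]_m) (i j k l : 'I_m).

Definition partial {W : normedModType R} i (f : 'rV[R]_m -> W) :
    'rV[R]_m -> W :=
  'D_(delta_mx 0 i) f.

Definition metric phi u : 'M[R]_m :=
  \matrix_(i, j) dot (partial i phi u) (partial j phi u).

Definition inv_metric phi u : 'M[R]_m := invmx (metric phi u).

(* Gamma^k_ij of the Levi-Civita connection of the induced metric. *)
Definition christoffel phi k i j u : R :=
  2^-1 * \sum_(l < m) inv_metric phi u k l *
    (partial i (fun w => metric phi w j l) u +
     partial j (fun w => metric phi w i l) u -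
     partial l (fun w => metric phi w i j) u).

(* The connection of i^*TS^n pulled back from the Levi-Civita connection of the
   sphere: the derivative in R^N projected onto T_(phi u) S^n = (phi u)^perp. *)
Definition sphere_conn phi i V u : 'rV[R]_N :=
  partial i V u - dot (partial i V u) (phi u) *: phi u.

Definition tangent_part phi (w : 'rV[R]_N) u : 'rV[R]_N :=
  \sum_(k < m) \sum_(l < m)
    (inv_metric phi u k l * dot w (partial l phi u)) *: partial k phi u.

Definition normal_part phi (w : 'rV[R]_N) u : 'rV[R]_N :=
  w - tangent_part phi w u.

(* B(d_i, d_j) = (nabla^S_(d_i) d_j)^perp. *)
Definition second_fundamental_form phi i j u : 'rV[R]_N :=
  normal_part phi (sphere_conn phi i (partial j phi) u) u.

Definition mean_curvature phi u : 'rV[R]_N :=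
  m%:R^-1 *: \sum_(i < m) \sum_(j < m)
    inv_metric phi u i j *: second_fundamental_form phi i j u.

(* (nabla^2 V)(d_i, d_j) = nabla_i nabla_j V - nabla_(nabla^M_i d_j) V. *)
Definition second_cov_derivative phi i j V u : 'rV[R]_N :=
  sphere_conn phi i (sphere_conn phi j V) u -
  \sum_(k < m) christoffel phi k i j u *: sphere_conn phi k V u.

Definition rough_laplacian phi V u : 'rV[R]_N :=
  - \sum_(i < m) \sum_(j < m)
      inv_metric phi u i j *: second_cov_derivative phi i j V u.

End LocalGeometry.

Definition harmonic_in_sphere {R : realType} {N : nat} (m : nat)
    (M : set 'rV[R]_N) : Prop :=
  submanifold_of_sphere m M /\
  forall (U : set 'rV[R]_m) (phi : 'rV[R]_m -> 'rV[R]_N),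
    local_parametrization M U phi ->
    forall u, U u -> mean_curvature phi u = 0.

Definition biharmonic_of_index_in_sphere {R : realType} {N : nat} (m : nat)
    (M : set 'rV[R]_N) (k : R) : Prop :=
  submanifold_of_sphere m M /\
  forall (U : set 'rV[R]_m) (phi : 'rV[R]_m -> 'rV[R]_N),
    local_parametrization M U phi ->
    forall u, U u ->
      rough_laplacian phi (mean_curvature phi) u
        - m%:R *: mean_curvature phi u + k *: mean_curvature phi u = 0.

(* Main.v *)
Require Import Defs.
From mathcomp Require Import all_boot all_order all_algebra.
From mathcomp Require Import mathcomp_extra boolp classical_sets functions.
From mathcomp Require Import reals.
From mathcomp Require Import topology normedtype landau derive.
From mathcomp Require Import ring.

Set Implicit Arguments.
Unset Strict Implicit.
Unset Printing Implicit Defensive.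

Import Order.TTheory GRing.Theory Num.Theory.
Import numFieldNormedType.Exports.

Local Open Scope classical_set_scope.
Local Open Scope ring_scope.

(** Write a point of the torus as z = (x, y), with |x| = a and |y| = b. The
    normal space of the torus in R^N is spanned by (x, 0) and (0, y), so its
    normal line in the sphere is spanned by eta = (b/a x, - a/b y), the image of
    z under a linear map of R^N. This linearity drives the whole proof. Both
    block norms are constant, so differentiating <phi E, phi> twice, with E a
    block projection, gives the normal components of the second derivatives of
    any parametrization phi: <d_i d_j phi E, phi> = - <d_i phi E, d_j phi>
    ([quadric_hessian]). Tracing with the inverse metric turns the right-hand
    side into - tr (P E), where P is the orthogonal projection onto the tangent
    space, and since P is the identity minus the projections onto (x, 0) and
    (0, y) ([tangent_projE]) these traces are n1 and n2.

    Hence H = phi D for the constant matrix D, a multiple of eta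
    ([mean_curvatureE]). Since <d_i phi D, phi> = 0, the connection of the
    sphere acts on this field by the plain derivative d_i phi D. The Levi-Civita
    term in the second covariant derivative is the tangential part of
    d_i d_j phi ([christoffel_tangent]); what remains is determined by the
    normal part of the traced Hessian, already known. The result is
    Delta H = (n1 b^2/a^2 + n2 a^2/b^2) H, that is, Delta H = |B|^2 H
    ([rough_laplacian_mean_curvature]). The index is then
    n1 + n2 - (n1 b^2/a^2 + n2 a^2/b^2).

    Two ingredients have to be built. The identification of the Christoffel
    symbols relies on the symmetry of second derivatives
    ([derive_commute_rV]), obtained from the mean value theorem. And the torus
    has to be shown to be a submanifold of the sphere: products of
    stereographic parametrizations of the two factors cover it
    ([torus_local_parametrization]), and being rational they are smooth. *)

(** * Symmetry of second derivatives *)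

(** Directional derivatives only see the difference quotient, so they can be
    compared across different domains; this covers both translations and
    restrictions to lines. *)
Lemma derive_same_quotient (R : realType) (V V' W : normedModType R)
    (f : V -> W) (g : V' -> W)
    (a v : V) (b w : V') :
  (forall h : R, f (h *: v + a) - f a = g (h *: w + b) - g b) ->
  'D_v f a = 'D_w g b.
Proof.
move=> fg; rewrite /derive.
suff -> : (fun h : R => h^-1 *: ((f \o shift a) (h *: v) - f a)) =
          (fun h : R => h^-1 *: ((g \o shift b) (h *: w) - g b)) by [].
by apply/funext => h /=; rewrite fg.
Qed.

Section DirectionalDerivatives.
Context {R : realType} {V : normedModType R}.
Implicit Types (x v w : V).

Lemma derive_translate (W : normedModType R) (f : V -> W) c x v :
  'D_v (fun y => f (y + c)) x = 'D_v f (x + c).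
Proof. by apply: derive_same_quotient => h; rewrite addrA. Qed.

Lemma differentiable_translate (W : normedModType R) (f : V -> W) c x :
  differentiable f (x + c) -> differentiable (fun y => f (y + c)) x.
Proof.
by move=> df; apply: (@differentiable_comp _ _ _ _ (fun y => y + c) f).
Qed.

Lemma is_derive_line (f : V -> R) x v t :
  differentiable f (x + t *: v) ->
  is_derive t 1 (fun s : R => f (x + s *: v)) ('D_v f (x + t *: v)).
Proof.
move=> df; have dl : differentiable (fun s : R => x + s *: v) t.
  by apply: differentiableD => //; exact: differentiableZl.
apply: DeriveDef; last first.
  apply: (@derive_same_quotient R R V R (fun s : R => f (x + s *: v)) f) => h.
  congr (f _ - _).
  by rewrite scalerDl [h *: 1]mulr1 addrCA.
exact/diff_derivable/(@differentiable_comp _ _ _ _ _ f).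
Qed.

Lemma MVT_line (f : V -> R) x v (h : R) : 0 < h ->
  (forall t, 0 <= t <= h -> differentiable f (x + t *: v)) ->
  exists2 t, 0 <= t <= h & f (x + h *: v) - f x = 'D_v f (x + t *: v) * h.
Proof.
move=> h0 df.
have cf : {within `[0, h], continuous (fun s : R => f (x + s *: v))}.
  apply: continuous_in_subspaceT => s; rewrite inE/= in_itv/= => sh.
  apply/differentiable_continuous.
  apply: (@differentiable_comp _ _ _ _ (fun s : R => x + s *: v) f).
    by apply: differentiableD => //; exact: differentiableZl.
  exact: df.
have [|c] := @MVT R _ (fun s => 'D_v f (x + s *: v)) 0 h h0 _ cf.
  move=> t; rewrite in_itv/= => /andP[t0 th]; apply/is_derive_line/df.
  by rewrite !ltW.
rewrite in_itv/= => /andP[c0 ch]; rewrite scale0r addr0 subr0 => eqf.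
by exists c; rewrite ?ltW.
Qed.

(** The mixed second difference is an exact second derivative at an intermediate
    point: apply the mean value theorem along v to the increment of f in the
    direction w, then along w to the derivative of f in the direction v. *)
Lemma second_difference (f : V -> R) x v w (h : R) : 0 < h ->
  (forall s t, 0 <= s <= h -> 0 <= t <= h ->
    differentiable f (x + s *: v + t *: w) /\
    differentiable ('D_v f) (x + s *: v + t *: w)) ->
  exists s t, [/\ 0 <= s <= h, 0 <= t <= h &
    f (x + h *: v + h *: w) - f (x + h *: v) - f (x + h *: w) + f x =
    'D_w ('D_v f) (x + s *: v + t *: w) * h ^+ 2].
Proof.
move=> h0 df.
have h1 : 0 <= h := ltW h0.
have hh : 0 <= h <= h by apply/andP.
have z0 : 0 <= (0 : R) <= h by apply/andP.
have df0 s : 0 <= s <= h -> differentiable f (x + s *: v).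
  by move=> /df /(_ z0)[]; rewrite scale0r addr0.
have [|s sh] := @MVT_line (fun y => f (y + h *: w) - f y) x v h h0.
  move=> s sh; apply: differentiableB; last exact: df0.
  by apply: differentiable_translate; have [] := df s h sh hh.
rewrite deriveB; first last.
- exact/diff_derivable/df0.
- by apply/diff_derivable/differentiable_translate; have [] := df s h sh hh.
rewrite derive_translate => eq1.
have [t th eq2] := @MVT_line ('D_v f) (x + s *: v) w h h0
  (fun t th => (df s t sh th).2).
exists s, t; split => //; rewrite expr2 mulrA -eq2 -eq1; ring.
Qed.

End DirectionalDerivatives.

Lemma near_eq_continuous (T U : topologicalType) (f g : T -> U) (x : T) :
  (\near x, f x = g x) -> {for x, continuous f} -> {for x, continuous g}.
Proof.
move=> fg; rewrite /prop_for /continuous_at -(nbhs_singleton fg) => cf.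
apply: cvg_trans cf; apply: near_eq_cvg.
by apply: filterS fg => y ->.
Qed.

Lemma near_eq_differentiable (R : numFieldType) (V W : normedModType R)
    (f g : V -> W) (x : V) :
  (\near x, f x = g x) -> differentiable f x -> differentiable g x.
Proof.
move=> fg df.
have fcont : continuous ('d f x) by exact: diff_continuous.
have eg : g \o shift x = cst (g x) + 'd f x +o_ (0 : V) id.
  apply/eqaddoP => e e0.
  have /eqaddoP/(_ e e0) := diff_locally df.
  have nfg : \forall h \near (0 : V), f (h + x) = g (h + x).
    by move: fg; rewrite (near_shift 0) subr0.
  move: nfg; apply: filterS2 => h /= fgh.
  by rewrite !fctE /= fgh (nbhs_singleton fg).
apply/diff_locallyP; split; first by rewrite (diff_unique fcont eg).
by rewrite (diff_unique fcont eg).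
Qed.

(** The second difference of f over the parallelogram spanned by h v and h w is
    symmetric in v and w. Expressing it through both mixed derivatives and
    letting h tend to 0 identifies them, by continuity at x. *)
Lemma derive_commute (R : realType) (V : normedModType R) (f : V -> R)
    (x v w : V) :
  (\forall y \near x, [/\ differentiable f y, differentiable ('D_v f) y &
     differentiable ('D_w f) y]) ->
  {for x, continuous ('D_w ('D_v f))} ->
  {for x, continuous ('D_v ('D_w f))} ->
  'D_w ('D_v f) x = 'D_v ('D_w f) x.
Proof.
move=> dfx cvw cwv; apply/eqP; rewrite -subr_eq0 -normr_le0.
apply/ler_addgt0Pr => e e0; rewrite add0r.
have e2 : 0 < e / 2 by rewrite divr_gt0.
have [r /= r0 rP] : exists2 r : R, 0 < r & forall y, `|y - x| < r ->
    [/\ differentiable f y, differentiable ('D_v f) y &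
     differentiable ('D_w f) y] /\
    `|'D_w ('D_v f) x - 'D_w ('D_v f) y| < e / 2 /\
    `|'D_v ('D_w f) x - 'D_v ('D_w f) y| < e / 2.
  have : \forall y \near x, [/\ differentiable f y, differentiable ('D_v f) y &
     differentiable ('D_w f) y] /\
    (`|'D_w ('D_v f) x - 'D_w ('D_v f) y| < e / 2 /\
    `|'D_v ('D_w f) x - 'D_v ('D_w f) y| < e / 2).
    apply: filterI => //; apply: filterI.
      by move/cvgrPdist_lt : cvw; exact.
    by move/cvgrPdist_lt : cwv; exact.
  move=> /nbhs_ballP[r /= r0 rP]; exists r => // y yx; apply: rP.
  by rewrite -ball_normE /= distrC.
pose c := `|v| + `|w| + 1.
have c0 : 0 < c by rewrite ltr_wpDl// addr_ge0.
(* h makes the whole parallelogram fit in the ball of radius r around x. *)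
pose h := r / (2 * c).
have h0 : 0 < h by rewrite divr_gt0// mulr_gt0.
have close s t : 0 <= s <= h -> 0 <= t <= h -> `|x + s *: v + t *: w - x| < r.
  move=> /andP[s0 sh] /andP[t0 th].
  rewrite -(addrA x) [x + _]addrC addrK (le_lt_trans (ler_normD _ _))// !normrZ.
  rewrite (ger0_norm s0) (ger0_norm t0).
  apply: (@le_lt_trans _ _ (h * c)).
    rewrite /c !mulrDr mulr1 -[leLHS]addr0 lerD ?(ltW h0)//.
    by rewrite lerD// ler_wpM2r.
  by rewrite /h invfM mulrA divfK ?gt_eqF// ltr_pdivrMr// ltr_pMr// ltr1n.
have close' s t : 0 <= s <= h -> 0 <= t <= h -> `|x + s *: w + t *: v - x| < r.
  by move=> sh th; rewrite (addrAC x); exact: close.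
have [|s [t [sh th eq1]]] := @second_difference _ _ f x v w h h0.
  by move=> s t sh th; have [[? ? ?] _] := rP _ (close _ _ sh th); split.
have [|s' [t' [sh' th' eq2]]] := @second_difference _ _ f x w v h h0.
  by move=> p q ph qh; have [[? ? ?] _] := rP _ (close' _ _ ph qh); split.
have [_ [b1 _]] := rP _ (close _ _ sh th).
have [_ [_ b2]] := rP _ (close' _ _ sh' th').
have h2 : h ^+ 2 != 0 by rewrite expf_neq0// gt_eqF.
have eqD : f (x + h *: v + h *: w) - f (x + h *: v) - f (x + h *: w) + f x =
    f (x + h *: w + h *: v) - f (x + h *: w) - f (x + h *: v) + f x.
  by rewrite (addrAC x (h *: w)); congr (_ + _); exact: addrAC.
move: eqD eq1 eq2 b1 b2 => ->.
move: ('D_w _ _) ('D_v _ _) ('D_w _ _) ('D_v _ _) (f _ - _ - _ + _).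
move=> P Q P' Q' D -> /(mulIf h2) -> b1 b2.
rewrite (le_trans (ler_distD Q' _ _))//.
by rewrite [leRHS]splitr lerD ?ltW// distrC.
Qed.

Section MatrixValued.
Context {R : realType} {V : normedModType R}.

Lemma is_derive_mx m n (f : V -> 'M[R]_(m, n)) (x v : V) (df : 'M[R]_(m, n)) :
  (forall i j, is_derive x v (fun y => f y i j) (df i j)) ->
  is_derive x v f df.
Proof.
move=> fij; have dv : derivable f x v by apply/derivable_mxP => i j.
apply: DeriveDef => //; rewrite derive_mx//; apply/matrixP => i j.
by rewrite mxE derive_val.
Qed.

Lemma is_derive_coord m n (f : V -> 'M[R]_(m, n)) (x v : V)
    (df : 'M[R]_(m, n)) i j :
  is_derive x v f df -> is_derive x v (fun y => f y i j) (df i j).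
Proof.
move=> [dv <-]; apply: DeriveDef; first by move/derivable_mxP : dv.
by rewrite derive_mx// mxE.
Qed.

Lemma is_derive_mulmxr m n p (f : V -> 'M[R]_(m, n)) (A : 'M[R]_(n, p))
    (x v : V) (df : 'M[R]_(m, n)) :
  is_derive x v f df -> is_derive x v (fun y => f y *m A) (df *m A).
Proof.
move=> fdf; apply: is_derive_mx => i j; rewrite mxE.
rewrite (_ : (fun _ => _) = \sum_k (A k j *: fun y => f y i k)); last first.
  apply/funext => y; rewrite mxE fct_sumE.
  by apply: eq_bigr => k _; rewrite mulrC.
apply: is_derive_eq.
  by apply: is_derive_sum => k; apply: is_deriveZ; exact: is_derive_coord.
by apply: eq_bigr => k _; rewrite mulrC.
Qed.

Lemma is_derive_dot n (f g : V -> 'rV[R]_n) (x v : V) (df dg : 'rV[R]_n) :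
  is_derive x v f df -> is_derive x v g dg ->
  is_derive x v (fun y => dot (f y) (g y)) (dot df (g x) + dot (f x) dg).
Proof.
move=> fdf gdg.
rewrite (_ : (fun _ => _) = \sum_k ((fun y => f y 0 k) * (fun y => g y 0 k)));
  last by apply/funext => y; rewrite fct_sumE.
apply: is_derive_eq.
  by apply: is_derive_sum => k; apply: is_deriveM; exact: is_derive_coord.
rewrite /dot -big_split /=; apply: eq_bigr => k _.
by rewrite addrC [_ *: df _ _]mulrC.
Qed.

Lemma differentiable_entry m n (f : V -> 'M[R]_(m, n)) (x : V) i j :
  differentiable f x -> differentiable (fun y => f y i j) x.
Proof.
move=> df; apply: (@differentiable_comp _ _ _ _ f (fun M => M i j)) => //.
exact: differentiable_coord.
Qed.

Lemma derive_entry m n (f : V -> 'M[R]_(m, n)) (x v : V) i j :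
  differentiable f x -> 'D_v f x i j = 'D_v (fun y => f y i j) x.
Proof.
move=> df; have dv := diff_derivable (v := v) df.
by rewrite (derive_mx dv) mxE.
Qed.

Lemma derive_commute_rV n (f : V -> 'rV[R]_n) (x v w : V) :
  (\forall y \near x, [/\ differentiable f y, differentiable ('D_v f) y &
     differentiable ('D_w f) y]) ->
  {for x, continuous ('D_w ('D_v f))} ->
  {for x, continuous ('D_v ('D_w f))} ->
  'D_w ('D_v f) x = 'D_v ('D_w f) x.
Proof.
(* Each coordinate of a derivative is the derivative of the coordinate, but only
   at points of differentiability: hence the passage through neighbourhoods. *)
move=> dfx cvw cwv.
have coord1 j u : \forall y \near x, 'D_u f y 0 j = 'D_u (fun z => f z 0 j) y.
  by apply: filterS dfx => y [df _ _]; exact: derive_entry.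
have coord2 j u u' : (\forall y \near x, differentiable ('D_u f) y) ->
  \forall y \near x, 'D_u' ('D_u f) y 0 j = 'D_u' ('D_u (fun z => f z 0 j)) y.
  move=> du; have /nbhs_interior := coord1 j u; move: du.
  apply: filterS2 => y du fu.
  rewrite (derive_entry _ _ _ du); exact: near_eq_derive.
have dv : \forall y \near x, differentiable ('D_v f) y.
  by apply: filterS dfx => y [].
have dw : \forall y \near x, differentiable ('D_w f) y.
  by apply: filterS dfx => y [].
have transfer j u u' : (\forall y \near x, differentiable ('D_u f) y) ->
  {for x, continuous ('D_u' ('D_u f))} ->
  {for x, continuous ('D_u' ('D_u (fun z => f z 0 j)))}.
  move=> du cu; have nE := coord2 j u u' du.
  have c1 : {for x, continuous (fun y => 'D_u' ('D_u f) y 0 j)}.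
    apply: (@continuous_comp _ _ _ ('D_u' ('D_u f)) (fun M => M 0 j)) => //.
    exact: coord_continuous.
  exact: near_eq_continuous nE c1.
have diffD j u y : (\near y, 'D_u f y 0 j = 'D_u (fun z => f z 0 j) y) ->
    differentiable ('D_u f) y -> differentiable ('D_u (fun z => f z 0 j)) y.
  by move=> nE /(differentiable_entry 0 j); exact: near_eq_differentiable.
apply/rowP => j.
have e1 := nbhs_singleton (coord2 j v w dv).
have e2 := nbhs_singleton (coord2 j w v dw).
apply: (etrans e1); apply: (etrans _ (esym e2)).
apply: derive_commute; [|exact: transfer|exact: transfer].
have /nbhs_interior n1 := coord1 j v.
have /nbhs_interior n2 := coord1 j w.
near=> y; have [df dvf dwf] : [/\ differentiable f y,
     differentiable ('D_v f) y & differentiable ('D_w f) y] by near: y.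
split; first exact: differentiable_entry.
  by apply: (diffD j v y _ dvf); near: y.
by apply: (diffD j w y _ dwf); near: y.
Unshelve. all: by end_near. Qed.

End MatrixValued.

(** * Euclidean product and orthogonal projections *)

Section Dot.
Context {R : realType} {n : nat}.
Implicit Types u v w : 'rV[R]_n.

Lemma dotE u v : dot u v = (u *m v^T) 0 0.
Proof. by rewrite mxE; apply: eq_bigr => i _; rewrite mxE. Qed.

Lemma dotC u v : dot u v = dot v u.
Proof. by apply: eq_bigr => i _; rewrite mulrC. Qed.

Lemma dotDl u v w : dot (u + v) w = dot u w + dot v w.
Proof. by rewrite !dotE mulmxDl mxE. Qed.

Lemma dotZl a u v : dot (a *: u) v = a * dot u v.
Proof. by rewrite !dotE -scalemxAl mxE. Qed.

Lemma dot_suml I (r : seq I) (P : pred I) (F : I -> 'rV[R]_n) v :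
  dot (\sum_(i <- r | P i) F i) v = \sum_(i <- r | P i) dot (F i) v.
Proof.
by rewrite dotE mulmx_suml summxE; apply: eq_bigr => i _; rewrite dotE.
Qed.

Lemma dot_mulmx u (A : 'M_n) v : dot (u *m A) v = dot u (v *m A^T).
Proof. by rewrite !dotE trmx_mul trmxK mulmxA. Qed.

Lemma dot_mulmx_sym u (A : 'M_n) v : A^T = A -> dot (u *m A) v = dot (v *m A) u.
Proof. by move=> sA; rewrite dot_mulmx sA dotC. Qed.

Lemma dot_ge0 u : 0 <= dot u u.
Proof. by apply: sumr_ge0 => i _; rewrite -expr2 sqr_ge0. Qed.

Lemma dot_eq0 u : dot u u = 0 -> u = 0.
Proof.
move=> /eqP; rewrite psumr_eq0 => [/allP u0|i _]; last first.
  by rewrite -expr2 sqr_ge0.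
apply/rowP => i; rewrite mxE; apply/eqP.
by have := u0 i; rewrite mem_index_enum mulf_eq0 orbb; exact.
Qed.

Lemma enorm_sqr u a : enorm u = a -> dot u u = a ^+ 2.
Proof. by move=> <-; rewrite /enorm sqr_sqrtr// dot_ge0. Qed.

Lemma scale_dot u v w : dot u v *: w = u *m (v^T *m w).
Proof. by rewrite mulmxA [u *m v^T]mx11_scalar -dotE mul_scalar_mx. Qed.

End Dot.

Lemma right_inverse_left (R : comNzRingType) m n (A : 'M[R]_(m, n))
  (B : 'M[R]_(n, m)) : m = n -> A *m B = 1%:M -> B *m A = 1%:M.
Proof. by move=> mn; subst n; exact: mulmx1C. Qed.

(** The orthogonal projection onto the row space of J complements the one onto
    the row space of F. The rows of J and F together form a square matrix K with
    K K^T block diagonal, so K^T (K K^T)^-1 is a two-sided inverse of K. *)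
Lemma projection_complement (R : comUnitRingType) m p N (J : 'M[R]_(m, N))
    (F : 'M[R]_(p, N)) : (m + p)%N = N ->
  J *m J^T \in unitmx -> F *m F^T = 1%:M -> J *m F^T = 0 ->
  J^T *m invmx (J *m J^T) *m J = 1%:M - F^T *m F.
Proof.
move=> mpN Gu FF JF.
have FJ : F *m J^T = 0 by rewrite -[F]trmxK -trmx_mul JF trmx0.
have : col_mx J F *m row_mx (J^T *m invmx (J *m J^T)) F^T = 1%:M.
  by rewrite mul_col_row !mulmxA mulmxV// FF JF FJ mul0mx -scalar_mx_block.
move=> /(right_inverse_left mpN); rewrite mul_row_col => <-.
by rewrite addrK.
Qed.

Section Jacobian.
Context {R : realType} {m N : nat}.
Variable phi : 'rV[R]_m -> 'rV[R]_N.

Definition jacobi u : 'M[R]_(m, N) := \matrix_(i < m) partial i phi u.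

Lemma metricE u : metric phi u = jacobi u *m (jacobi u)^T.
Proof.
by apply/matrixP => i j; rewrite !mxE; apply: eq_bigr => k _; rewrite !mxE.
Qed.

Lemma inv_metric_sym u : (inv_metric phi u)^T = inv_metric phi u.
Proof. by rewrite /inv_metric trmx_inv metricE trmx_mul trmxK. Qed.

Definition tangent_proj u : 'M[R]_N :=
  (jacobi u)^T *m inv_metric phi u *m jacobi u.

Lemma tangent_partE w u : tangent_part phi w u = w *m tangent_proj u.
Proof.
have wE l : (w *m (jacobi u)^T) 0 l = dot w (partial l phi u).
  by rewrite mxE; apply: eq_bigr => k _; rewrite !mxE.
rewrite /tangent_proj !mulmxA; apply/rowP => c; rewrite mxE summxE.
apply: eq_bigr => k _; rewrite summxE mxE big_distrl /=.
apply: eq_bigr => l _; rewrite wE !mxE.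
by rewrite -[in LHS]inv_metric_sym mxE; ring.
Qed.

(** This is how the trace of a bilinear form over the tangent space, taken with
    the inverse metric, becomes the trace of an N x N matrix; the cast fixes the
    ring structure at which the product is elaborated. *)
Lemma trace_metric (E : 'M[R]_N) u :
  \sum_i \sum_j inv_metric phi u i j *
    dot ((partial j phi u : 'rV[R]_N) *m E) (partial i phi u)
  = \tr (tangent_proj u *m E).
Proof.
have dE i j : (jacobi u *m E *m (jacobi u)^T) j i =
    dot ((partial j phi u : 'rV[R]_N) *m E) (partial i phi u).
  rewrite dotE [LHS]mxE [RHS]mxE; apply: eq_bigr => k _; rewrite !mxE.
  by congr (_ * _); apply: eq_bigr => l _; rewrite mxE.
rewrite /tangent_proj -!mulmxA mxtrace_mulC -mulmxA.
apply: eq_bigr => i _; rewrite mxE.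
by apply: eq_bigr => j _; rewrite -dE.
Qed.

End Jacobian.

Section Immersion.
Context {R : realType} {m N : nat}.
Variables (phi : 'rV[R]_m -> 'rV[R]_N) (u : 'rV[R]_m).
Hypotheses (dphi : differentiable phi u) (inj_dphi : injective ('d phi u)).

Lemma diff_jacobi v : 'd phi u v = v *m jacobi phi u.
Proof.
rewrite {1}[v]row_sum_delta linear_sum mulmx_sum_row; apply: eq_bigr => i _.
by rewrite linearZ rowK /partial deriveE.
Qed.

(** The metric is the Gram matrix J J^T of the rows of J, which are independent
    because [phi] is an immersion. *)
Lemma metric_unit : metric phi u \in unitmx.
Proof.
rewrite -row_free_unit; apply: inj_row_free => v.
rewrite metricE mulmxA => vJJ.
apply: inj_dphi; rewrite linear0 diff_jacobi; apply: dot_eq0.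
by rewrite dotE trmx_mul mulmxA vJJ mul0mx mxE.
Qed.

End Immersion.

(** * Calculus in a parametrization *)

Section Calculus.
Context {R : realType} {m N : nat}.
Variables (U : set 'rV[R]_m) (phi : 'rV[R]_m -> 'rV[R]_N).
Hypotheses (openU : open U) (smooth_phi : smooth_on U phi).

Lemma near_dom u : U u -> \near u, U u.
Proof. by move=> Uu; move: openU; rewrite openE; apply. Qed.

Lemma near_eq_on T (f g : 'rV[R]_m -> T) u :
  {in U, f =1 g} -> U u -> \near u, f u = g u.
Proof. by move=> fg /near_dom; apply: filterS => w Uw; rewrite fg ?inE. Qed.

Lemma partial_eq_on (W : normedModType R) (f g : 'rV[R]_m -> W) i u :
  {in U, f =1 g} -> U u -> partial i f u = partial i g u.
Proof. by move=> fg Uu; apply: near_eq_derive; exact: near_eq_on. Qed.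

Lemma phi_differentiable u : U u -> differentiable phi u.
Proof. by move=> Uu; have [/= + _] := smooth_phi 1; exact. Qed.

Lemma partial_differentiable i u : U u -> differentiable (partial i phi) u.
Proof.
by move=> Uu; have [/= _ /(_ (delta_mx 0 i))[+ _]] := smooth_phi 2; exact.
Qed.

Lemma is_derive_phi i u : U u ->
  is_derive u (delta_mx 0 i) phi (partial i phi u).
Proof. by move=> /phi_differentiable/diff_derivable/derivableP. Qed.

Lemma is_derive_partial i j u : U u ->
  is_derive u (delta_mx 0 i) (partial j phi) (partial i (partial j phi) u).
Proof. by move=> /partial_differentiable/diff_derivable/derivableP. Qed.

Lemma partial_commute i j u : U u ->
  partial i (partial j phi) u = partial j (partial i phi) u.
Proof.
move=> Uu; have c k l : {for u, continuous (partial k (partial l phi))}.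
  have [/= _ /(_ (delta_mx 0 l))[_ /(_ (delta_mx 0 k))]] := smooth_phi 2.
  exact.
apply: derive_commute_rV; [|exact: c|exact: c].
apply: filterS (near_dom Uu) => w Uw; split.
- exact: phi_differentiable.
- exact: partial_differentiable.
- exact: partial_differentiable.
Qed.

(* Unfolding derivatives to limits makes unification intractable. *)
Opaque partial.

Lemma partial_metric l i j u : U u ->
  partial l (fun w => metric phi w i j) u =
    dot (partial l (partial i phi) u) (partial j phi u) +
    dot (partial l (partial j phi) u) (partial i phi u).
Proof.
move=> Uu; rewrite (_ : (fun _ => _) =
    fun w => dot (partial i phi w) (partial j phi w)); last first.
  by apply/funext => w; rewrite mxE.
rewrite [X in _ + X]dotC.
have [_] := is_derive_dot (is_derive_partial l i Uu) (is_derive_partial l j Uu).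
exact.
Qed.

(** Gauss formula: by the symmetry of second derivatives, the Koszul expression
    for the Christoffel symbols collapses to <d_i d_j phi, d_l phi>. *)
Lemma christoffel_tangent i j u : U u ->
  \sum_k christoffel phi k i j u *: partial k phi u =
  tangent_part phi (partial i (partial j phi) u) u.
Proof.
move=> Uu; apply: eq_bigr => k _; rewrite -scaler_suml; congr (_ *: _).
rewrite /christoffel mulr_sumr; apply: eq_bigr => l _.
pose d p q r := dot (partial p (partial q phi) u) (partial r phi u).
have dS p q r : d p q r = d q p r.
  exact: (congr1 (fun z => dot z _) (partial_commute p q Uu)).
have dE p q r : partial p (fun w => metric phi w q r) u = d p q r + d p r q.
  exact: partial_metric.
rewrite -/(d i j l) !dE; move: d dS {dE} => d dS.
rewrite (dS j i) (dS l i) (dS l j).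
by move: (d _ _ _) (d _ _ _) (d _ _ _) (inv_metric _ _ _ _) => p q r g; field.
Qed.

Section Quadric.
Variables (E : 'M[R]_N) (c : R).
Hypotheses (symE : E^T = E)
  (qE : forall w, U w -> dot (phi w *m E) (phi w) = c).

Lemma quadric_normal i u : U u ->
  dot ((partial i phi u : 'rV[R]_N) *m E) (phi u) = 0.
Proof.
move=> Uu; have [_ d1] := is_derive_dot
  (is_derive_mulmxr E (is_derive_phi i Uu)) (is_derive_phi i Uu).
have d0 : partial i (fun w => dot (phi w *m E) (phi w)) u = 0.
  rewrite (partial_eq_on (g := cst c) i _ Uu); first exact: derive_cst.
  by move=> w; rewrite inE; exact: qE.
have := etrans (esym d1) d0.
rewrite (dot_mulmx_sym (phi u) (partial i phi u) symE) -mulr2n.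
by move=> /eqP; rewrite mulrn_eq0/= => /eqP.
Qed.

(** Differentiating <phi E, phi> = c once gives [quadric_normal], valid on all
    of U, so that it can be differentiated again. *)
Lemma quadric_hessian i j u : U u ->
  dot ((partial i (partial j phi) u : 'rV[R]_N) *m E) (phi u) =
  - dot ((partial j phi u : 'rV[R]_N) *m E) (partial i phi u).
Proof.
move=> Uu; have [_ d1] := is_derive_dot
  (is_derive_mulmxr E (is_derive_partial i j Uu)) (is_derive_phi i Uu).
have d0 : partial i
    (fun w => dot ((partial j phi w : 'rV[R]_N) *m E) (phi w)) u = 0.
  rewrite (partial_eq_on (g := cst 0) i _ Uu); first exact: derive_cst.
  by move=> w; rewrite inE; exact: quadric_normal.
by have /eqP := etrans (esym d1) d0; rewrite addr_eq0 => /eqP.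
Qed.

End Quadric.

(** A linear field z D along [phi], whose derivatives stay tangent to the
    sphere, so that the projection in the connection has no effect at first
    order. *)
Section LinearField.
Variables (V : 'rV[R]_m -> 'rV[R]_N) (D : 'M[R]_N).
Hypothesis VE : {in U, V =1 fun w => phi w *m D}.
Hypothesis D_tangent : forall i w, U w ->
  dot ((partial i phi w : 'rV[R]_N) *m D) (phi w) = 0.

Lemma sphere_conn_linear_field i u : U u ->
  sphere_conn phi i V u = (partial i phi u : 'rV[R]_N) *m D.
Proof.
move=> Uu; rewrite /sphere_conn (partial_eq_on i VE Uu).
have [_ dV] := is_derive_mulmxr D (is_derive_phi i Uu).
rewrite [partial i _ u]dV D_tangent // scale0r subr0 //.
Qed.

Lemma second_cov_derivative_linear_field i j u : U u ->
  second_cov_derivative phi i j V u =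
  (partial i (partial j phi) u : 'rV[R]_N) *m
    (D *m (1%:M - (phi u)^T *m phi u) - tangent_proj phi u *m D).
Proof.
move=> Uu; rewrite mulmxBr (mulmxA _ D) (mulmxA _ (tangent_proj phi u)).
rewrite -tangent_partE -christoffel_tangent //.
rewrite mulmx_suml mulmxBr mulmx1 -scale_dot /second_cov_derivative.
congr (_ - _); last first.
  by apply: eq_bigr => k _; rewrite sphere_conn_linear_field // scalemxAl.
rewrite {1}/sphere_conn.
have [_ dV] := is_derive_mulmxr D (is_derive_partial i j Uu).
have -> // : partial i (sphere_conn phi j V) u =
    (partial i (partial j phi) u : 'rV[R]_N) *m D.
rewrite -[RHS]dV; apply: partial_eq_on => // w; rewrite inE.
exact: sphere_conn_linear_field.
Qed.

End LinearField.

End Calculus.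

(** * Mean curvature of the torus and its Laplacian *)

Section LinearMaps.
Context {R : comNzRingType}.

Definition fst_proj n1 n2 : 'M[R]_(n1 + n2) := block_mx 1%:M 0 0 0.
Definition snd_proj n1 n2 : 'M[R]_(n1 + n2) := block_mx 0 0 0 1%:M.

Context {n1 n2 : nat}.
Local Notation E1 := (fst_proj n1 n2).
Local Notation E2 := (snd_proj n1 n2).

Lemma fst_projE m (z : 'M_(m, n1 + n2)) : z *m E1 = row_mx (lsubmx z) 0.
Proof.
by rewrite -{1}[z]hsubmxK mul_row_block !mulmx0 mulmx1 !addr0.
Qed.

Lemma snd_projE m (z : 'M_(m, n1 + n2)) : z *m E2 = row_mx 0 (rsubmx z).
Proof.
by rewrite -{1}[z]hsubmxK mul_row_block !mulmx0 mulmx1 !add0r.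
Qed.

Lemma fst_proj_sym : E1^T = E1.
Proof. by rewrite tr_block_mx !trmx0 trmx1. Qed.

Lemma snd_proj_sym : E2^T = E2.
Proof. by rewrite tr_block_mx !trmx0 trmx1. Qed.

Lemma fst_snd_add : E1 + E2 = 1%:M.
Proof. by rewrite add_block_mx !addr0 !add0r -scalar_mx_block. Qed.

Lemma fst_projK : E1 *m E1 = E1.
Proof.
by rewrite mulmx_block !(mulmx0, mul0mx, mulmx1, addr0, add0r) ?block_mx0.
Qed.

Lemma snd_projK : E2 *m E2 = E2.
Proof.
by rewrite mulmx_block !(mulmx0, mul0mx, mulmx1, addr0, add0r) ?block_mx0.
Qed.

Lemma fst_snd_mul : E1 *m E2 = 0.
Proof.
by rewrite mulmx_block !(mulmx0, mul0mx, mulmx1, addr0, add0r) ?block_mx0.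
Qed.

Lemma snd_fst_mul : E2 *m E1 = 0.
Proof.
by rewrite mulmx_block !(mulmx0, mul0mx, mulmx1, addr0, add0r) ?block_mx0.
Qed.

Lemma fst_proj_trace : \tr E1 = n1%:R.
Proof. by rewrite mxtrace_block mxtrace1 mxtrace0 addr0. Qed.

Lemma snd_proj_trace : \tr E2 = n2%:R.
Proof. by rewrite mxtrace_block mxtrace1 mxtrace0 add0r. Qed.

End LinearMaps.

Opaque partial.

Section TorusGeometry.
Context {R : realType} {n1 n2 : nat}.
Variables (a b : R) (U : set 'rV[R]_(n1 + n2))
  (phi : 'rV[R]_(n1 + n2) -> 'rV[R]_(n1.+1 + n2.+1)).
Hypotheses (a0 : 0 < a) (b0 : 0 < b) (ab1 : a ^+ 2 + b ^+ 2 = 1).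
Hypotheses (m0 : (0 < n1 + n2)%N).
Hypothesis param : local_parametrization (clifford_torus n1 n2 a b) U phi.

Local Notation m := (n1 + n2)%N.
Local Notation N := (n1.+1 + n2.+1)%N.
Local Notation E1 := (fst_proj (R := R) n1.+1 n2.+1).
Local Notation E2 := (snd_proj (R := R) n1.+1 n2.+1).

Lemma torus_fst u : U u -> dot (phi u *m E1) (phi u) = a ^+ 2.
Proof.
move=> Uu.
have [W _ imW] := lp_open_map param (lp_open param) (@subset_refl _ U).
have : (phi @` U) (phi u) by exists u.
rewrite imW => -[[/enorm_sqr <- _] _].
rewrite dotE fst_projE -{2}[phi u]hsubmxK tr_row_mx mul_row_col mul0mx addr0.
by rewrite -dotE.
Qed.

Lemma torus_snd u : U u -> dot (phi u *m E2) (phi u) = b ^+ 2.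
Proof.
move=> Uu.
have [W _ imW] := lp_open_map param (lp_open param) (@subset_refl _ U).
have : (phi @` U) (phi u) by exists u.
rewrite imW => -[[_ /enorm_sqr <-] _].
rewrite dotE snd_projE -{2}[phi u]hsubmxK tr_row_mx mul_row_col mul0mx add0r.
by rewrite -dotE.
Qed.

Let openU : open U := lp_open param.
Let smooth_phi : smooth_on U phi := lp_smooth param.

Lemma normal_fst i u : U u ->
  dot ((partial i phi u : 'rV[R]_N) *m E1) (phi u) = 0.
Proof.
by move=> Uu; apply: (quadric_normal openU smooth_phi _ torus_fst i Uu);
  exact: fst_proj_sym.
Qed.

Lemma normal_snd i u : U u ->
  dot ((partial i phi u : 'rV[R]_N) *m E2) (phi u) = 0.
Proof.
by move=> Uu; apply: (quadric_normal openU smooth_phi _ torus_snd i Uu);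
  exact: snd_proj_sym.
Qed.

(** The tangent space together with (x, 0) and (0, y) spans R^N: n1 + n2
    independent tangent vectors orthogonal to these two fill the dimension. *)
Lemma tangent_projE u : U u -> tangent_proj phi u = 1%:M -
  (a ^- 2 *: ((phi u *m E1)^T *m (phi u *m E1)) +
   b ^- 2 *: ((phi u *m E2)^T *m (phi u *m E2))).
Proof.
move=> Uu; pose F : 'M[R]_(1 + 1, N) :=
  col_mx (a^-1 *: (phi u *m E1)) (b^-1 *: (phi u *m E2)).
have Fm : a ^- 2 *: ((phi u *m E1)^T *m (phi u *m E1)) +
   b ^- 2 *: ((phi u *m E2)^T *m (phi u *m E2)) = F^T *m F.
  rewrite tr_col_mx mul_row_col !linearZ /= -!scalemxAl !scalerA.
  by rewrite -!invfM -!expr2.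
rewrite Fm /tangent_proj /inv_metric metricE; apply: projection_complement.
- by rewrite addn2 addnS.
- rewrite -metricE; apply: metric_unit (lp_immersion param Uu).
  exact: phi_differentiable smooth_phi _ Uu.
- have dF (E E' : 'M[R]_N) : (phi u *m E) *m (phi u *m E')^T =
      (dot (phi u *m (E *m E'^T)) (phi u))%:M.
    rewrite [LHS]mx11_scalar -dotE; congr (_ %:M).
    by rewrite mulmxA [RHS]dot_mulmx trmxK.
  have ZF (c d : R) (v w : 'rV[R]_N) :
      (c *: v) *m (d *: w)^T = (c * d) *: (v *m w^T).
    by rewrite linearZ /= -scalemxAl -scalemxAr scalerA.
  rewrite tr_col_mx mul_col_row !ZF !dF fst_proj_sym snd_proj_sym.
  rewrite fst_projK snd_projK fst_snd_mul snd_fst_mul.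
  rewrite torus_fst // torus_snd // mulmx0.
  rewrite (_ : dot 0 (phi u) = 0); last by rewrite dotE mul0mx mxE.
  rewrite !scale_scalar_mx !mulr0 !raddf0.
  rewrite (_ : a^-1 / a * _ = 1); last by field; rewrite gt_eqF.
  rewrite (_ : b^-1 / b * _ = 1); last by field; rewrite gt_eqF.
  by rewrite -scalar_mx_block.
- rewrite tr_col_mx mul_mx_row -row_mx0 !linearZ /=.
  have J0 (E : 'M[R]_N) : E^T = E ->
      (forall i, dot ((partial i phi u : 'rV[R]_N) *m E) (phi u) = 0) ->
      jacobi phi u *m (phi u *m E)^T = 0.
    move=> sE dE; rewrite trmx_mul sE mulmxA; apply/colP => i.
    rewrite [RHS]mxE -(dE i) dotE [LHS]mxE [RHS]mxE.
    apply: eq_bigr => k _; rewrite !mxE; congr (_ * _).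
    by apply: eq_bigr => l _; rewrite mxE.
  rewrite (J0 _ fst_proj_sym) ?(J0 _ snd_proj_sym) ?scaler0 // => i.
    exact: normal_snd.
  exact: normal_fst.
Qed.

Lemma normal_projE w u : U u -> w *m (1%:M - tangent_proj phi u) =
  (a ^- 2 * dot (w *m E1) (phi u)) *: (phi u *m E1) +
  (b ^- 2 * dot (w *m E2) (phi u)) *: (phi u *m E2).
Proof.
move=> Uu; rewrite tangent_projE // opprB addrC subrK mulmxDr.
rewrite -!scalemxAr -!scale_dot !scalerA.
by rewrite [dot (w *m E1) _]dot_mulmx [dot (w *m E2) _]dot_mulmx
  fst_proj_sym snd_proj_sym.
Qed.

(** The projection onto the tangent space of the first factor has rank n1: one
    less than the block, the radial direction being removed. *)
Lemma trace_fst u : U u -> \tr (tangent_proj phi u *m E1) = n1%:R.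
Proof.
move=> Uu; rewrite tangent_projE // mulmxBl mul1mx raddfB /= fst_proj_trace.
rewrite mulmxDl -!scalemxAl -!mulmxA snd_fst_mul fst_projK !mulmx0 scaler0 addr0.
rewrite mxtraceZ mxtrace_mulC [X in \tr X]mx11_scalar mxtrace_scalar -dotE.
rewrite dot_mulmx fst_proj_sym -mulmxA fst_projK dotC torus_fst //.
by rewrite mulVf ?expf_neq0 ?gt_eqF// -natr1 addrK.
Qed.

Lemma trace_snd u : U u -> \tr (tangent_proj phi u *m E2) = n2%:R.
Proof.
move=> Uu; rewrite tangent_projE // mulmxBl mul1mx raddfB /= snd_proj_trace.
rewrite mulmxDl -!scalemxAl -!mulmxA fst_snd_mul snd_projK !mulmx0 scaler0 add0r.
rewrite mxtraceZ mxtrace_mulC [X in \tr X]mx11_scalar mxtrace_scalar -dotE.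
rewrite dot_mulmx snd_proj_sym -mulmxA snd_projK dotC torus_snd //.
by rewrite mulVf ?expf_neq0 ?gt_eqF// -natr1 addrK.
Qed.

(** The Christoffel terms are left out: they only add a tangent vector, which
    does not affect the normal components used below. *)
Definition hessian_trace u : 'rV[R]_N :=
  \sum_i \sum_j inv_metric phi u i j *: partial i (partial j phi) u.

Lemma hessian_trace_mul p u (L : 'M[R]_(_, p)) :
  \sum_i \sum_j inv_metric phi u i j *:
    ((partial i (partial j phi) u : 'rV[R]_N) *m L) =
  hessian_trace u *m L.
Proof.
rewrite mulmx_suml; apply: eq_bigr => i _; rewrite mulmx_suml.
by apply: eq_bigr => j _; rewrite scalemxAl.
Qed.

Lemma dot_hessian_trace (E : 'M[R]_N) c u : E^T = E ->
  (forall w, U w -> dot (phi w *m E) (phi w) = c) -> U u ->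
  dot (hessian_trace u *m E) (phi u) = - \tr (tangent_proj phi u *m E).
Proof.
move=> sE qE Uu; rewrite -hessian_trace_mul dot_suml -trace_metric -sumrN.
apply: eq_bigr => i _; rewrite dot_suml -sumrN; apply: eq_bigr => j _.
by rewrite dotZl (quadric_hessian openU smooth_phi sE qE)// mulrN.
Qed.

Lemma dot_hessian_fst u : U u -> dot (hessian_trace u *m E1) (phi u) = - n1%:R.
Proof.
by move=> Uu; rewrite (dot_hessian_trace fst_proj_sym torus_fst)// trace_fst.
Qed.

Lemma dot_hessian_snd u : U u -> dot (hessian_trace u *m E2) (phi u) = - n2%:R.
Proof.
by move=> Uu; rewrite (dot_hessian_trace snd_proj_sym torus_snd)// trace_snd.
Qed.

Lemma hessian_normal u : U u ->
  hessian_trace u *m (1%:M - tangent_proj phi u) =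
  - (n1%:R / a ^+ 2) *: (phi u *m E1) - (n2%:R / b ^+ 2) *: (phi u *m E2).
Proof.
move=> Uu; rewrite normal_projE // dot_hessian_fst // dot_hessian_snd //.
by rewrite !mulrN ![_^-1 * _]mulrC !scaleNr.
Qed.

Lemma phi_normal u : U u -> phi u *m (1%:M - tangent_proj phi u) = phi u.
Proof.
move=> Uu; rewrite normal_projE // torus_fst // torus_snd //.
rewrite !mulVf ?expf_neq0 ?gt_eqF// !scale1r -mulmxDr fst_snd_add mulmx1 //.
Qed.

(** Up to the factor 1/(a b), the coefficient of H on the unit normal
    eta = (b/a x, - a/b y). *)
Definition mean_coef : R := (n2%:R * a ^+ 2 - n1%:R * b ^+ 2) / m%:R.
Definition mean_mx : 'M[R]_N :=
  (mean_coef / a ^+ 2) *: E1 - (mean_coef / b ^+ 2) *: E2.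

Lemma mean_curvatureE u : U u -> mean_curvature phi u = phi u *m mean_mx.
Proof.
move=> Uu; rewrite /mean_curvature.
have BE i j : second_fundamental_form phi i j u =
    (partial i (partial j phi) u : 'rV[R]_N) *m
    ((1%:M - (phi u)^T *m phi u) *m (1%:M - tangent_proj phi u)).
  rewrite mulmxA [RHS]mulmxBr mulmx1 -tangent_partE.
  by rewrite mulmxBr mulmx1 -scale_dot.
under eq_bigr => i _ do under eq_bigr => j _ do rewrite BE.
rewrite hessian_trace_mul mulmxA (mulmxBr (hessian_trace u) 1%:M) mulmx1.
rewrite -scale_dot mulmxBl -scalemxAl.
rewrite phi_normal // hessian_normal //.
(* The two block traces add up to the dimension of the torus. *)
have -> : dot (hessian_trace u) (phi u) = - m%:R.
  rewrite -[hessian_trace u]mulmx1 -fst_snd_add mulmxDr dotDl.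
  by rewrite dot_hessian_fst // dot_hessian_snd // natrD opprD.
have phiE : phi u = phi u *m E1 + phi u *m E2.
  by rewrite -mulmxDr fst_snd_add mulmx1.
rewrite [X in _ - _ *: X]phiE /mean_mx mulmxBr -!scalemxAr.
have mE : m%:R = n1%:R + n2%:R :> R by rewrite natrD.
have mN0 : m%:R != 0 :> R by rewrite pnatr_eq0 -lt0n.
apply/rowP => k; rewrite !mxE.
move: ((phi u *m E1) 0 k) ((phi u *m E2) 0 k) => x y.
have pN0 : a ^+ 2 != 0 by rewrite expf_neq0// gt_eqF.
have qN0 : b ^+ 2 != 0 by rewrite expf_neq0// gt_eqF.
have qE : b ^+ 2 = 1 - a ^+ 2 by rewrite -ab1; ring.
rewrite /mean_coef qE mE in mN0 qN0 *.
by move: (a ^+ 2) pN0 qN0 => p pN0 qN0; field; apply/and3P.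
Qed.

Lemma mean_mx_normal i u : U u ->
  dot ((partial i phi u : 'rV[R]_N) *m mean_mx) (phi u) = 0.
Proof.
move=> Uu; rewrite /mean_mx mulmxBr -!scalemxAr dotDl -scaleNr !dotZl.
by rewrite normal_fst // normal_snd // !mulr0 addr0.
Qed.

(** The factor is the squared norm of the second fundamental form, as for any
    hypersurface of the sphere whose mean curvature is constant. *)
Lemma rough_laplacian_mean_curvature u : U u ->
  rough_laplacian phi (mean_curvature phi) u =
  (n1%:R * b ^+ 2 / a ^+ 2 + n2%:R * a ^+ 2 / b ^+ 2) *: mean_curvature phi u.
Proof.
move=> Uu; rewrite /rough_laplacian.
have VE : {in U, mean_curvature phi =1 fun w => phi w *m mean_mx}.
  by move=> w; rewrite inE; exact: mean_curvatureE.
under eq_bigr => i _ do under eq_bigr => j _ do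
  rewrite (second_cov_derivative_linear_field openU smooth_phi VE
    mean_mx_normal i j Uu).
rewrite hessian_trace_mul mulmxBr (mulmxA _ mean_mx) mulmxBr mulmx1.
rewrite -scale_dot (mulmxA _ (tangent_proj phi u)).
have -> : hessian_trace u *m tangent_proj phi u = hessian_trace u +
    (n1%:R / a ^+ 2) *: (phi u *m E1) + (n2%:R / b ^+ 2) *: (phi u *m E2).
  have := hessian_normal Uu; rewrite mulmxBr mulmx1 scaleNr.
  move=> /(congr1 (fun z => hessian_trace u - z)); rewrite subKr => ->.
  by rewrite !opprD !opprK addrA.
rewrite mean_curvatureE //.
have -> : dot (hessian_trace u *m mean_mx) (phi u) =
    - (mean_coef / a ^+ 2 * n1%:R) + mean_coef / b ^+ 2 * n2%:R.
  rewrite /mean_mx mulmxBr -!scalemxAr dotDl -scaleNr !dotZl.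
  by rewrite dot_hessian_fst // dot_hessian_snd // mulrN mulrNN.
rewrite !mulmxDl -!scalemxAl.
have fstD : phi u *m E1 *m mean_mx = (mean_coef / a ^+ 2) *: (phi u *m E1).
  rewrite /mean_mx -mulmxA mulmxBr -!scalemxAr fst_projK fst_snd_mul scaler0.
  by rewrite subr0 -scalemxAr.
have sndD : phi u *m E2 *m mean_mx = - (mean_coef / b ^+ 2) *: (phi u *m E2).
  rewrite /mean_mx -mulmxA mulmxBr -!scalemxAr snd_projK snd_fst_mul scaler0.
  by rewrite sub0r mulmxN -scalemxAr scaleNr.
rewrite fstD sndD.
have phiE : phi u = phi u *m E1 + phi u *m E2.
  by rewrite -mulmxDr fst_snd_add mulmx1.
rewrite [X in _ - _ *: X]phiE [in RHS]phiE mulmxDl fstD sndD.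
move: (hessian_trace u *m mean_mx) => A.
apply/rowP => k; rewrite !mxE.
move: ((phi u *m E1) 0 k) ((phi u *m E2) 0 k) (A 0 k) => x y {}A.
have pN0 : a ^+ 2 != 0 by rewrite expf_neq0// gt_eqF.
have qN0 : b ^+ 2 != 0 by rewrite expf_neq0// gt_eqF.
have qE : b ^+ 2 = 1 - a ^+ 2 by rewrite -ab1; ring.
rewrite qE in qN0 *; move: mean_coef (a ^+ 2) pN0 qN0 => s p pN0 qN0.
by field; apply/andP.
Qed.

Lemma biharmonic_equation u : U u ->
  rough_laplacian phi (mean_curvature phi) u
    - m%:R *: mean_curvature phi u
    + ((1 - b ^+ 2 / a ^+ 2) * n1%:R + (1 - a ^+ 2 / b ^+ 2) * n2%:R) *:
      mean_curvature phi u = 0.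
Proof.
move=> Uu; rewrite rough_laplacian_mean_curvature // -scalerBl -scalerDl.
rewrite [X in X *: _](_ : _ = 0) ?scale0r// natrD.
have pN0 : a ^+ 2 != 0 by rewrite expf_neq0// gt_eqF.
have qN0 : b ^+ 2 != 0 by rewrite expf_neq0// gt_eqF.
by move: (a ^+ 2) (b ^+ 2) pN0 qN0 => p q pN0 qN0; field; apply/andP.
Qed.

End TorusGeometry.

(** * Smooth functions *)

Section SmoothFunctions.
Context {R : realType} {V W : normedModType R}.
Local Notation smooth k f := (class_C k [set: V] f).

Lemma class_C_differentiable k (f : V -> W) x :
  smooth k.+1 f -> differentiable f x.
Proof. by move=> [df _]; exact: df. Qed.

Lemma class_C_derivable k (f : V -> W) x v : smooth k.+1 f -> derivable f x v.
Proof. by move=> /class_C_differentiable df; exact: diff_derivable. Qed.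

(** Differentiability at one level provides the continuity required at the
    end of the level below. *)
Lemma class_CW k (f : V -> W) : smooth k.+1 f -> smooth k f.
Proof.
elim: k f => [|k IHk] f [df ddf].
  by move=> x _; apply/differentiable_continuous/df.
by split => // v; apply: IHk; exact: ddf.
Qed.

Lemma class_C_cst k (c : W) : smooth k (cst c : V -> W).
Proof.
elim: k c => [c x _|k IHk c]; first exact: cst_continuous.
split=> [x _|v]; first exact: differentiable_cst.
rewrite (_ : 'D_v _ = cst 0) //.
by apply/funext => x; rewrite derive_cst.
Qed.

Lemma class_CD k (f g : V -> W) : smooth k f -> smooth k g -> smooth k (f + g).
Proof.
elim: k f g => [|k IHk] f g sf sg.
  by move=> x Ux; apply: continuousD; [exact: sf|exact: sg].
split=> [x _|v].
  by apply: differentiableD; [case: sf|case: sg] => + _; exact.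
rewrite (_ : 'D_v _ = 'D_v f + 'D_v g).
  by apply: IHk; [apply sf.2|apply sg.2].
by apply/funext => x; rewrite (deriveD (class_C_derivable sf)
  (class_C_derivable sg)).
Qed.

Lemma class_C_sum k n (f : 'I_n -> V -> W) :
  (forall i, smooth k (f i)) -> smooth k (\sum_i f i).
Proof.
move=> sf; elim/big_ind : _ => [|g h|i _] //; first exact: class_C_cst.
exact: class_CD.
Qed.

Lemma class_CZl k (f : V -> R) (w : W) :
  smooth k f -> smooth k (fun x => f x *: w).
Proof.
elim: k f => [|k IHk] f sf.
  by move=> x Ux; apply: cvgZr_tmp; exact: sf.
have df x : differentiable f x by case: sf => df _; exact: df.
split=> [x _|v]; first exact: differentiableZl.
rewrite (_ : 'D_v _ = fun x => 'D_v f x *: w); first by apply: IHk; apply sf.2.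
apply/funext => x; rewrite deriveE; last exact: differentiableZl.
by rewrite (diffZl w (df x)) /= -deriveE.
Qed.

End SmoothFunctions.

Section SmoothScalar.
Context {R : realType} {V : normedModType R}.
Local Notation smooth k f := (class_C k [set: V] f).

Lemma class_CM k (f g : V -> R) : smooth k f -> smooth k g -> smooth k (f * g).
Proof.
elim: k f g => [|k IHk] f g sf sg.
  by move=> x Ux; apply: continuousM; [exact: sf|exact: sg].
split=> [x _|v].
  by apply: differentiableM; [case: sf|case: sg] => + _; exact.
rewrite (_ : 'D_v _ = f * 'D_v g + g * 'D_v f); last first.
  by apply/funext => x; rewrite (deriveM (class_C_derivable sf)
    (class_C_derivable sg)).
apply: class_CD; apply: IHk; try exact: class_CW.
- by apply sg.2.
- by apply sf.2.
Qed.

Lemma class_CV k (f : V -> R) : (forall x, f x != 0) -> smooth k f ->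
  smooth k (fun x => (f x)^-1).
Proof.
move=> f0; elim: k => [|k IHk] sf.
  by move=> x Ux; apply: cvgV => //; exact: sf.
split=> [x _|v].
  by apply: differentiableV; [case: sf => + _; exact|exact: f0].
have sV := IHk (class_CW sf).
rewrite (_ : 'D_v _ = (cst (-1) * ((fun x => (f x)^-1) * (fun x => (f x)^-1))) *
    'D_v f); last first.
  apply/funext => x; rewrite (deriveV (f0 x) (class_C_derivable sf)).
  by rewrite !fctE /= mulN1r -invfM -expr2.
apply: class_CM; last by apply sf.2.
by apply: class_CM; [exact: class_C_cst|exact: class_CM].
Qed.

Lemma class_C_mx k n (f : V -> 'rV[R]_n) :
  (forall i, smooth k (fun x => f x 0 i)) -> smooth k f.
Proof.
move=> sf; rewrite (_ : f = \sum_i (fun x => f x 0 i *: delta_mx 0 i)).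
  by apply: class_C_sum => i; exact: class_CZl.
by apply/funext => x; rewrite fct_sumE -row_sum_delta.
Qed.

End SmoothScalar.

Lemma class_C_coord (R : realType) n k i :
  class_C k [set: 'rV[R]_n] (fun x : 'rV[R]_n => x 0 i).
Proof.
case: k => [x _|k]; first exact: coord_continuous.
split=> [x _|v]; first exact: differentiable_coord.
rewrite (_ : 'D_v _ = cst (v 0 i)); first exact: class_C_cst.
apply/funext => x.
by have [_] := is_derive_coord 0 i (is_derive_id x v).
Qed.

(** * The torus is a submanifold of the sphere *)

Section Stereographic.
Context {R : realType} {n : nat}.
Variables (s a : R).
Implicit Types (w : 'rV[R]_n) (z : 'rV[R]_(1 + n)).

(** The inverse of the stereographic projection of the sphere of radius a, with
    the pole at height s a on the axis of the first coordinate; both signs s are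
    needed to cover the sphere. *)
Definition stereo w : 'rV[R]_(1 + n) :=
  (a / (dot w w + 1)) *: row_mx (s * (dot w w - 1))%:M (2 *: w).

Definition stereo_inv z : 'rV[R]_n := (a - s * z 0 (lshift n 0))^-1 *: rsubmx z.

Lemma stereo0 w :
  stereo w 0 (lshift n 0) = a / (dot w w + 1) * (s * (dot w w - 1)).
Proof. by rewrite mxE row_mxEl mxE. Qed.

Lemma stereo_rshift w : rsubmx (stereo w) = (a / (dot w w + 1) * 2) *: w.
Proof. by rewrite linearZ /= row_mxKr scalerA. Qed.

Lemma dot_rV1n z : dot z z = z 0 (lshift n 0) ^+ 2 + dot (rsubmx z) (rsubmx z).
Proof.
rewrite /dot big_split_ord big_ord1 /= expr2.
by congr (_ + _); apply: eq_bigr => i _; rewrite mxE.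
Qed.

Lemma dot_add1_neq0 w : dot w w + 1 != 0.
Proof. by rewrite gt_eqF// ltr_wpDl// dot_ge0. Qed.

Hypotheses (s1 : s ^+ 2 = 1) (a0 : a != 0).

Lemma stereo_sphere w : dot (stereo w) (stereo w) = a ^+ 2.
Proof.
rewrite dot_rV1n stereo0 stereo_rshift dotZl dotC dotZl.
have := dot_add1_neq0 w; move: (dot w w) => q q0.
rewrite [X in X + _](_ : _ = s ^+ 2 * (a / (q + 1) * (q - 1)) ^+ 2);
  last by ring.
by rewrite s1; field.
Qed.

Lemma stereo_pole w : a - s * stereo w 0 (lshift n 0) = 2 * a / (dot w w + 1).
Proof.
rewrite stereo0; have := dot_add1_neq0 w; move: (dot w w) => q q0.
rewrite [X in _ - X](_ : _ = s ^+ 2 * (a / (q + 1) * (q - 1))); last by ring.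
by rewrite s1; field.
Qed.

Lemma stereo_pole_neq0 w : a - s * stereo w 0 (lshift n 0) != 0.
Proof.
by rewrite stereo_pole mulf_neq0 ?mulf_neq0 ?invr_eq0 ?dot_add1_neq0 ?pnatr_eq0.
Qed.

Lemma stereoK w : stereo_inv (stereo w) = w.
Proof.
rewrite /stereo_inv stereo_pole stereo_rshift scalerA.
have := dot_add1_neq0 w; move: (dot w w) => q q0.
by rewrite (_ : _ * _ = 1) ?scale1r//; field; apply/andP.
Qed.

Lemma stereo_invK z : dot z z = a ^+ 2 -> a - s * z 0 (lshift n 0) != 0 ->
  stereo (stereo_inv z) = z.
Proof.
rewrite dot_rV1n => zz d0.
have qE : dot (stereo_inv z) (stereo_inv z) =
    (a + s * z 0 (lshift n 0)) / (a - s * z 0 (lshift n 0)).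
  rewrite dotZl dotC dotZl.
  have -> : dot (rsubmx z) (rsubmx z) =
      (a + s * z 0 (lshift n 0)) * (a - s * z 0 (lshift n 0)).
    rewrite mulrC -subr_sqr exprMn s1 mul1r -zz; ring.
  by field.
have coef : a / (dot (stereo_inv z) (stereo_inv z) + 1) =
    (a - s * z 0 (lshift n 0)) / 2.
  have -> : dot (stereo_inv z) (stereo_inv z) + 1 =
      2 * a / (a - s * z 0 (lshift n 0)) by rewrite qE; field.
  by field; apply/andP.
rewrite /stereo coef qE -[RHS]hsubmxK scale_row_mx; congr row_mx.
  rewrite scale_scalar_mx [RHS]mx11_scalar mxE; congr (_%:M).
  rewrite (_ : _ * _ = s ^+ 2 * z 0 (lshift n 0)); last by field.
  by rewrite s1 mul1r.
rewrite /stereo_inv !scalerA (_ : _ * _ = 1) ?scale1r//.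
by field.
Qed.

(** The immersion property. The last coordinates of z = stereo w are
    (a - s z_0) w; if dz = 0, differentiating leaves (a - s z_0) dw, and
    a - s z_0 does not vanish. *)
Lemma stereo_kernel (V : normedModType R) (l : V -> 'rV[R]_n) (x v : V)
    (dl : 'rV[R]_n) :
  is_derive x v l dl -> is_derive x v (fun y => stereo (l y)) 0 -> dl = 0.
Proof.
move=> ldl d0; apply/rowP => j; rewrite mxE; apply/eqP.
have d1 k : is_derive x v (fun y => stereo (l y) 0 k) 0.
  by have := is_derive_coord 0 k d0; rewrite mxE.
have dlj := is_derive_coord 0 j ldl.
have [_] : is_derive x v (fun y => stereo (l y) 0 (rshift 1 j))
    ((a - s * stereo (l x) 0 (lshift n 0)) * dl 0 j).
  rewrite (_ : (fun _ => _) =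
    (cst a - s *: (fun y => stereo (l y) 0 (lshift n 0))) * (fun y => l y 0 j)).
    by apply: is_derive_eq; rewrite [s *: 0]scaler0 subr0 scaler0 addr0.
  apply/funext => y; rewrite !fctE stereo_pole.
  have := congr1 (fun z : 'rV_n => z 0 j) (stereo_rshift (l y)).
  rewrite [LHS]mxE [RHS]mxE => ->; congr (_ * _).
  by rewrite mulrC mulrA.
have [_ ->] := d1 (rshift 1 j) => /esym/eqP.
by rewrite mulf_eq0 (negbTE (stereo_pole_neq0 _)).
Qed.

Lemma class_C_stereo (V : normedModType R) k (l : V -> 'rV[R]_n) i :
  (forall j, class_C k setT (fun x => l x 0 j)) ->
  class_C k setT (fun x => stereo (l x) 0 i).
Proof.
move=> sl.
have sq c : class_C k setT (fun x => dot (l x) (l x) + c).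
  rewrite (_ : (fun _ => _) =
    \sum_j ((fun x => l x 0 j) * (fun x => l x 0 j)) + cst c); last first.
    by apply/funext => x; congr (_ + _); rewrite fct_sumE.
  apply: class_CD; last exact: class_C_cst.
  by apply: class_C_sum => j; exact: class_CM.
have sf : class_C k setT (fun x => a / (dot (l x) (l x) + 1)).
  apply: (@class_CM _ _ _ (cst a) (fun x => (dot (l x) (l x) + 1)^-1)).
    exact: class_C_cst.
  by apply: class_CV => // x; exact: dot_add1_neq0.
under eq_fun do rewrite mxE.
apply: (class_CM sf); case: (splitP i) => j ij.
  have -> : i = lshift n j by apply: val_inj; rewrite /= ij.
  rewrite (ord1 j).
  rewrite (_ : (fun _ => _) = fun x => s * (dot (l x) (l x) - 1)); last first.
    by apply/funext => x; rewrite row_mxEl mxE.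
  by apply: (@class_CM _ _ _ (cst s)); [exact: class_C_cst|exact: sq].
have -> : i = rshift 1 j by apply: val_inj; rewrite /= ij.
under eq_fun do rewrite row_mxEr mxE.
by apply: (@class_CM _ _ _ (cst 2)); [exact: class_C_cst|exact: sl].
Qed.

End Stereographic.

Lemma continuous_mx (R : realType) (T : topologicalType) m n
    (f : T -> 'M[R]_(m, n)) x :
  (forall i j, {for x, continuous (fun y => f y i j)}) -> {for x, continuous f}.
Proof.
move=> cf A [P fP PA]; apply: filterS PA _.
have : \forall y \near x, forall i j, P i j (f y i j).
  by apply: filter_forall => i; apply: filter_forall => j; exact: cf (fP i j).
exact.
Qed.

Section BlockDerivative.
Context {R : realType} {V : normedModType R} {n1 n2 : nat}.

Lemma is_derive_lsubmx (f : V -> 'rV[R]_(n1 + n2)) (x v : V)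
    (df : 'rV[R]_(n1 + n2)) :
  is_derive x v f df -> is_derive x v (fun y => lsubmx (f y)) (lsubmx df).
Proof.
move=> fdf; apply: is_derive_mx => i j; rewrite mxE.
by under eq_fun do rewrite mxE; exact: is_derive_coord.
Qed.

Lemma is_derive_rsubmx (f : V -> 'rV[R]_(n1 + n2)) (x v : V)
    (df : 'rV[R]_(n1 + n2)) :
  is_derive x v f df -> is_derive x v (fun y => rsubmx (f y)) (rsubmx df).
Proof.
move=> fdf; apply: is_derive_mx => i j; rewrite mxE.
by under eq_fun do rewrite mxE; exact: is_derive_coord.
Qed.

End BlockDerivative.

Lemma lsubmx_coord_continuous (R : realType) n1 n2 i :
  continuous (fun z : 'rV[R]_(n1 + n2) => lsubmx z 0 i).
Proof. by under eq_fun do rewrite mxE; exact: coord_continuous. Qed.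

Lemma rsubmx_coord_continuous (R : realType) n1 n2 i :
  continuous (fun z : 'rV[R]_(n1 + n2) => rsubmx z 0 i).
Proof. by under eq_fun do rewrite mxE; exact: coord_continuous. Qed.

Section TorusParametrization.
Context {R : realType} {n1 n2 : nat}.
Variables (s t a b : R).
Hypotheses (s1 : s ^+ 2 = 1) (t1 : t ^+ 2 = 1) (a0 : 0 < a) (b0 : 0 < b).

Definition torus_param (u : 'rV[R]_(n1 + n2)) : 'rV[R]_(n1.+1 + n2.+1) :=
  row_mx (stereo s a (lsubmx u) : 'rV[R]_n1.+1)
         (stereo t b (rsubmx u) : 'rV[R]_n2.+1).

Definition torus_chart (z : 'rV[R]_(n1.+1 + n2.+1)) : 'rV[R]_(n1 + n2) :=
  row_mx (stereo_inv s a (lsubmx z : 'rV[R]_n1.+1))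
         (stereo_inv t b (rsubmx z : 'rV[R]_n2.+1)).

Definition fst_pole_gap (z : 'rV[R]_(n1.+1 + n2.+1)) : R :=
  a - s * (lsubmx z : 'rV[R]_(1 + n1)) 0 (lshift n1 0).
Definition snd_pole_gap (z : 'rV[R]_(n1.+1 + n2.+1)) : R :=
  b - t * (rsubmx z : 'rV[R]_(1 + n2)) 0 (lshift n2 0).

Let aN0 : a != 0. Proof. by rewrite gt_eqF. Qed.
Let bN0 : b != 0. Proof. by rewrite gt_eqF. Qed.

Lemma torus_param_in u : clifford_torus n1 n2 a b (torus_param u).
Proof.
rewrite /clifford_torus /torus_param /= row_mxKl row_mxKr /enorm.
by rewrite !stereo_sphere // !sqrtr_sqr !gtr0_norm.
Qed.

Lemma torus_paramK : cancel torus_param torus_chart.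
Proof.
move=> u; rewrite /torus_chart /torus_param row_mxKl row_mxKr.
by rewrite !stereoK // hsubmxK.
Qed.

Lemma torus_chartK z : clifford_torus n1 n2 a b z ->
  fst_pole_gap z != 0 -> snd_pole_gap z != 0 -> torus_param (torus_chart z) = z.
Proof.
move=> [/enorm_sqr za /enorm_sqr zb] h1 h2.
rewrite /torus_param /torus_chart row_mxKl row_mxKr.
by rewrite !stereo_invK // hsubmxK.
Qed.

Lemma pole_gap_torus_param u :
  fst_pole_gap (torus_param u) != 0 /\ snd_pole_gap (torus_param u) != 0.
Proof.
rewrite /fst_pole_gap /snd_pole_gap /torus_param row_mxKl row_mxKr.
by split; exact: stereo_pole_neq0.
Qed.

Lemma torus_param_smooth : smooth_on setT torus_param.
Proof.
move=> k; apply: class_C_mx => i; rewrite /torus_param.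
case: (splitP i) => j ij.
  have -> : i = lshift n2.+1 j by apply: val_inj; rewrite /= ij.
  under eq_fun do rewrite row_mxEl.
  apply: (@class_C_stereo R n1 s a _ k lsubmx j) => l.
  by under eq_fun do rewrite mxE; exact: class_C_coord.
have -> : i = rshift n1.+1 j by apply: val_inj; rewrite /= ij.
under eq_fun do rewrite row_mxEr.
apply: (@class_C_stereo R n2 t b _ k rsubmx j) => l.
by under eq_fun do rewrite mxE; exact: class_C_coord.
Qed.

Lemma torus_param_immersion u : injective ('d torus_param u).
Proof.
have du : differentiable torus_param u.
  by have [/= + _] := torus_param_smooth 1; exact.
suff ker v : 'd torus_param u v = 0 -> v = 0.
  move=> v w vw; apply/eqP; rewrite -subr_eq0; apply/eqP/ker.
  by rewrite linearB /= vw subrr.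
rewrite -deriveE // => dv0.
have d0 : is_derive u v torus_param 0.
  by rewrite -dv0; apply: derivableP; exact: diff_derivable.
have l0 : lsubmx v = 0.
  apply: (stereo_kernel s1 aN0 (is_derive_lsubmx (is_derive_id u v))).
  have := is_derive_lsubmx d0; rewrite linear0.
  by under eq_fun do rewrite row_mxKl.
have r0 : rsubmx v = 0.
  apply: (stereo_kernel t1 bN0 (is_derive_rsubmx (is_derive_id u v))).
  have := is_derive_rsubmx d0; rewrite linear0.
  by under eq_fun do rewrite row_mxKr.
by rewrite -[v]hsubmxK l0 r0 row_mx0.
Qed.

Lemma fst_pole_gap_continuous : continuous fst_pole_gap.
Proof.
have -> : fst_pole_gap = cst a - cst s *
      (fun z : 'rV[R]_(n1.+1 + n2.+1) =>
        (lsubmx z : 'rV[R]_(1 + n1)) 0 (lshift n1 0)).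
  by apply/funext.
move=> z; apply: continuousB; first exact: cst_continuous.
by apply: continuousM; [exact: cst_continuous|exact: lsubmx_coord_continuous].
Qed.

Lemma snd_pole_gap_continuous : continuous snd_pole_gap.
Proof.
have -> : snd_pole_gap = cst b - cst t *
      (fun z : 'rV[R]_(n1.+1 + n2.+1) =>
        (rsubmx z : 'rV[R]_(1 + n2)) 0 (lshift n2 0)).
  by apply/funext.
move=> z; apply: continuousB; first exact: cst_continuous.
by apply: continuousM; [exact: cst_continuous|exact: rsubmx_coord_continuous].
Qed.

Lemma torus_chart_continuous z : fst_pole_gap z != 0 -> snd_pole_gap z != 0 ->
  {for z, continuous torus_chart}.
Proof.
move=> h1 h2; apply: continuous_mx => i j; rewrite (ord1 i).
case: (splitP j) => l jl.
  have -> : j = lshift n2 l by apply: val_inj; rewrite /= jl.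
  rewrite (_ : (fun _ => _) = fun y : 'rV[R]_(n1.+1 + n2.+1) =>
    (fst_pole_gap y)^-1 * (lsubmx y : 'rV[R]_(1 + n1)) 0 (rshift 1 l));
    last first.
    apply/funext => y.
    by rewrite /torus_chart row_mxEl /fst_pole_gap /stereo_inv !mxE.
  apply: continuousM; last exact: lsubmx_coord_continuous.
  by apply: continuousV => //; exact: fst_pole_gap_continuous.
have -> : j = rshift n1 l by apply: val_inj; rewrite /= jl.
rewrite (_ : (fun _ => _) = fun y : 'rV[R]_(n1.+1 + n2.+1) =>
  (snd_pole_gap y)^-1 * (rsubmx y : 'rV[R]_(1 + n2)) 0 (rshift 1 l));
  last first.
  apply/funext => y.
  by rewrite /torus_chart row_mxEr /snd_pole_gap /stereo_inv !mxE.
apply: continuousM; last exact: rsubmx_coord_continuous.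
by apply: continuousV => //; exact: snd_pole_gap_continuous.
Qed.

(** The explicit inverse [torus_chart], continuous at the points neither
    component of which is a pole, gives injectivity and shows that images of
    open sets are relatively open. *)
Lemma torus_local_parametrization :
  local_parametrization (clifford_torus n1 n2 a b) setT torus_param.
Proof.
split.
- exact: openT.
- exact: torus_param_smooth.
- by move=> u _; exact: torus_param_immersion.
- by move=> u v _ _; exact: can_inj torus_paramK u v.
move=> W openW _.
exists [set z |
    [/\ fst_pole_gap z != 0, snd_pole_gap z != 0 & W (torus_chart z)]].
  rewrite openE => z [h1 h2 Wz]; rewrite /interior.
  have n1z : \forall y \near z, fst_pole_gap y != 0.
    exact: (cvgr_neq0 (fst_pole_gap z) (fst_pole_gap_continuous (x:=z)) h1).
  have n2z : \forall y \near z, snd_pole_gap y != 0.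
    exact: (cvgr_neq0 (snd_pole_gap z) (snd_pole_gap_continuous (x:=z)) h2).
  have nWz : \forall y \near z, W (torus_chart y).
    apply: (torus_chart_continuous h1 h2).
    by move: openW; rewrite openE; apply.
  near=> y; split; near: y => //.
apply/seteqP; split=> [_ [u Wu <-]|z [Mz [h1 h2 Wz]]].
  split; first exact: torus_param_in.
  have [h1 h2] := pole_gap_torus_param u.
  by split => //; rewrite torus_paramK.
by exists (torus_chart z) => //; exact: torus_chartK.
Unshelve. all: by end_near. Qed.

End TorusParametrization.

(** A point cannot be at both poles, so one of the two signs avoids it. *)
Lemma exists_pole_sign (R : realType) (a x : R) : 0 < a ->
  exists2 s : R, s ^+ 2 = 1 & a - s * x != 0.
Proof.
move=> a0; have [->|xa] := eqVneq x a.
  exists (-1); first by rewrite sqrrN expr1n.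
  by rewrite mulN1r opprK gt_eqF// addr_gt0.
by exists 1; rewrite ?expr1n// mul1r subr_eq0 eq_sym.
Qed.

Lemma clifford_torus_submanifold (R : realType) n1 n2 (a b : R) :
  0 < a -> 0 < b -> a ^+ 2 + b ^+ 2 = 1 ->
  submanifold_of_sphere (n1 + n2) (clifford_torus n1 n2 a b).
Proof.
move=> a0 b0 ab1; split=> [z [/enorm_sqr za /enorm_sqr zb]|z Mz].
  have zz : dot z z = 1.
    by rewrite -ab1 -za -zb {1}/dot big_split_ord /=; congr (_ + _);
      apply: eq_bigr => i _; rewrite !mxE.
  by rewrite /unit_sphere /enorm /= zz sqrtr1.
have [s s1 h1] :=
  exists_pole_sign ((lsubmx z : 'rV_(1 + n1)) 0 (lshift n1 0)) a0.
have [t t1 h2] :=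
  exists_pole_sign ((rsubmx z : 'rV_(1 + n2)) 0 (lshift n2 0)) b0.
exists setT, (torus_param s t a b); split.
  exact: torus_local_parametrization.
by exists (torus_chart s t a b z) => //; exact: torus_chartK.
Qed.

(** * The index of the torus *)

Theorem proposition1p11 (R : realType) (a b : R) (n1 n2 : nat)
    (ha0 : 0 < a) (ha1 : a < 1) (hb : b = Num.sqrt (1 - a ^+ 2))
    (hn1 : (0 < n1)%N) (hn2 : (0 < n2)%N)
    (hT : ~ harmonic_in_sphere (n1 + n2)%N (clifford_torus n1 n2 a b)) :
  biharmonic_of_index_in_sphere (n1 + n2)%N (clifford_torus n1 n2 a b)
    ((1 - b ^+ 2 / a ^+ 2) * n1%:R + (1 - a ^+ 2 / b ^+ 2) * n2%:R).
Proof.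
have a2 : 0 < 1 - a ^+ 2 by rewrite subr_gt0 expr_lt1 // ltW.
have b0 : 0 < b by rewrite hb sqrtr_gt0.
have ab1 : a ^+ 2 + b ^+ 2 = 1 by rewrite hb sqr_sqrtr ?(ltW a2) // addrC subrK.
split; first exact: clifford_torus_submanifold.
move=> U phi param u Uu; apply: (biharmonic_equation ha0 b0 ab1 _ param Uu).
by rewrite addn_gt0 hn1.
Qed.
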